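(* Consider the iterates of the noisy-data RIGKT algorithm (described in the context) with $\mu_1>0$ and with parameters $\tau>1$, $\mu_0>0$ chosen such that $$\mathfrak C_0:=1-\frac1\tau-\frac{\mu_0}{4\nu}>0 .$$ Let $\hat u\in\mathcal S$, and put $\Gamma_{k,m}^\delta:=D_{\mathfrak f}^{\zeta_{k,m}^\delta}(\hat u,u_{k,m}^\delta)$ and $\Gamma_{k}^\delta:=D_{\mathfrak f}^{\zeta_{k}^\delta}(\hat u,u_{k}^\delta)$. Then for all integers $0\le k\le k_\delta$ and $m=0,\dots,m_k-1$, $$\Gamma_{k,m+1}^\delta-\Gamma_{k,m}^\delta\le-\mathfrak C_0\,t_{k,m}^\delta\|h_{k,m}^\delta\|^2\qquad\text{and}\qquad \Gamma_{k+1,0}^\delta-\Gamma_{k+1}^\delta\le-\mathfrak C_0\,t_{k+1}^\delta\,\Phi_{k+1}^\delta .$$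
   Context: A discretization level is fixed and suppressed in the notation. The finite-dimensional solution space is identified with $\mathbb R^{n_2}$ with the Euclidean inner product $\langle\cdot,\cdot\rangle$ and norm; $^*$ denotes transpose. Functional: $\mathfrak f:\mathbb R^{n_2}\to\mathbb R\cup\{+\infty\}$ is proper, lower semicontinuous and $\nu$-strongly convex with $\nu>0$, i.e. $\mathfrak f(\lambda u+(1-\lambda)\bar u)+\nu\lambda(1-\lambda)\|u-\bar u\|^2\le\lambda \mathfrak f(u)+(1-\lambda)\mathfrak f(\bar u)$ for all $u,\bar u\in\operatorname{dom}(\mathfrak f)$, $\lambda\in[0,1]$. For $\zeta\in\partial \mathfrak f(u)$ the Bregman distance is $D_{\mathfrak f}^{\zeta}(\bar u,u)=\mathfrak f(\bar u)-\mathfrak f(u)-\langle\zeta,\bar u-u\rangle$. Write $P(\zeta):=\arg\min_u\{\mathfrak f(u)-\langle\zeta,u\rangle\}$ (unique minimizer, so $\zeta\in\partial \mathfrak f(P(\zeta))$). Projected systems: for $i=1,\dots,q$ let $\mathcal T_i\in\mathbb R^{n_1\times n_2}$, exact data $v_i\in\mathbb R^{n_1}$, and $1\le l<\min\{n_1,n_2\}$. Golub–Kahan bidiagonalization of $\mathcal T_i$ (in the paper with starting vector $v_i^\delta$) gives $\mathcal T_iV_i=U_iB_i$ and $\mathcal T_i^*U_i'=V_i(B_i')^*$, where $V_i\in\mathbb R^{n_2\times l}$ and $U_i\in\mathbb R^{n_1\times(l+1)}$ have orthonormal columns, $B_i\in\mathbb R^{(l+1)\times l}$ is lower bidiagonal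 of rank $l$, $U_i'$ consists of the first $l$ columns of $U_i$ and $B_i'$ of the first $l$ rows of $B_i$. Put $\mathcal T_i^l:=U_iB_iV_i^*$ and assume $\mathcal S:=\{u\in\operatorname{dom}(\mathfrak f):\mathcal T_i^lu=v_i,\ i=1,\dots,q\}\neq\emptyset$. Noisy data: $v_i^\delta\in\mathbb R^{n_1}$ with $\|v_i^\delta-v_i\|\le\delta_i$, $\delta=(\delta_1^2+\dots+\delta_q^2)^{1/2}$. Regularization parameters: $(\gamma_j)_{j\ge0}$ is a monotonically decreasing sequence of positive reals with $\sum_j1/\gamma_j=\infty$. In the algorithm, $\gamma_{k,m}:=\gamma_{\mathfrak z_{k,m}}$ and (for outer updates) $\gamma_k:=\gamma_{\mathfrak z_k}$, where $\mathfrak z_{k,m}$, $\mathfrak z_k$ are the total numbers of (inner and outer) updates performed up to the inner step $(k,m)$, respectively the outer step $k$: $\mathfrak z_{k,m}=\sum_{j<k}m_j+k+m$ and $\mathfrak z_k=\sum_{j<k}m_j+k-1$ for $k\ge1$. Below, a symbol $\gamma_k$ attached to an outer step is understood in this sense. Noisy-data RIGKT algorithm. Input: $\tau>1,\mu_0>0,\mu_1>0$, $\zeta_0\in\mathbb R^{n_2}$, positive integers $m_0,m_1,\dots$. Set $\zeta_{0,0}^\delta=\zeta_0^\delta=\zeta_0$, $u_{0,0}^\delta=u_0^\delta=P(\zeta_0)$. For $k=0,1,2,\dots$: (inner loop) for $m=0,\dots,m_k-1$: draw $i=i_{k,m}\in\{1,\dots,q\}$ uniformly at random (independently); with $A=\gamma_{k,m}I+B_iB_i^*$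 set $h_{k,m}^\delta=A^{-1/2}U_i^*(\mathcal T_i^lu_{k,m}^\delta-v_i^\delta)$, $g_{k,m}^\delta=V_iB_i^*A^{-1/2}h_{k,m}^\delta$; $t_{k,m}^\delta=\min\{\mu_0\|h_{k,m}^\delta\|^2/\|g_{k,m}^\delta\|^2,\mu_1\}$ if $\gamma_{k,m}\|h_{k,m}^\delta\|^2>\tau^2\delta_i^2$ and $t_{k,m}^\delta=0$ otherwise; $\zeta_{k,m+1}^\delta=\zeta_{k,m}^\delta-t_{k,m}^\delta g_{k,m}^\delta$, $u_{k,m+1}^\delta=P(\zeta_{k,m+1}^\delta)$. (outer step) $\zeta_{k+1}^\delta=\zeta_{k,m_k}^\delta$, $u_{k+1}^\delta=u_{k,m_k}^\delta$. With $K=k+1$, $A_{K,i}=\gamma_KI+B_iB_i^*$, $h_{K,i}^\delta=A_{K,i}^{-1/2}U_i^*(\mathcal T_i^lu_K^\delta-v_i^\delta)$: if $\gamma_K\|h_{K,i}^\delta\|^2\le\tau^2\delta_i^2$ for all $i$, the algorithm stops with output $u_K^\delta$. Put $\Delta_K^\delta=\{i:\gamma_K\|h_{K,i}^\delta\|^2>\tau^2\delta_i^2\}$, $g_K^\delta=\sum_{i\in\Delta_K^\delta}V_iB_i^*A_{K,i}^{-1/2}h_{K,i}^\delta$, $\Phi_K^\delta=\sum_{i\in\Delta_K^\delta}\|h_{K,i}^\delta\|^2$; $t_K^\delta=\min\{\mu_0\Phi_K^\delta/\|g_K^\delta\|^2,\mu_1\}$ if $\Delta_K^\delta\ne\emptyset$,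 $t_K^\delta=0$ otherwise; $\zeta_{K,0}^\delta=\zeta_K^\delta-t_K^\delta g_K^\delta$, $u_{K,0}^\delta=P(\zeta_{K,0}^\delta)$. A quotient with $g=0$ in the denominator is read as $+\infty$ (step size $\mu_1$). The stopping index $k_\delta$ is the smallest $k\ge1$ with $\gamma_k\|h_{k,i}^\delta\|^2\le\tau^2\delta_i^2$ for all $i$ ($k_\delta=\infty$ if there is none). The recursion is understood as formally continued past $k_\delta$, so all iterates are defined. *)

(* Defs.v *)
From HB Require Import structures.
From mathcomp Require Import all_boot all_order all_algebra.
From mathcomp Require Import all_classical all_reals all_analysis.

Set Implicit Arguments.
Unset Strict Implicit.
Unset Printing Implicit Defensive.

Import Order.TTheory GRing.Theory Num.Theory.
Import numFieldNormedType.Exports.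

Local Open Scope classical_set_scope.
Local Open Scope ring_scope.

(* The library norm on matrices is the sup norm; the Euclidean inner product
   and norm are therefore defined here.  The topology is the same. *)
Definition dot (R : realType) (n : nat) (u v : 'cV[R]_n) : R :=
  (u^T *m v) 0 0.

Definition enorm (R : realType) (n : nat) (u : 'cV[R]_n) : R :=
  Num.sqrt (dot u u).

(* A^{-1/2}: the symmetric positive semidefinite square root of A^{-1}; it
   exists and is unique when A is symmetric positive definite. *)
Definition inv_sqrtmx (R : realType) (n : nat) (A : 'M[R]_n) : 'M[R]_n :=
  get [set S : 'M[R]_n | [/\ S^T = S,
                             forall x : 'cV[R]_n, 0 <= dot x (S *m x) &
                             S *m S = invmx A]].

Section Functional.
Variables (R : realType) (n : nat).
Implicit Types (f : 'cV[R]_n -> \bar R) (u w z : 'cV[R]_n).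

Definition effdom f : set 'cV[R]_n := [set u | (f u < +oo)%E].

(* The first conjunct says that f takes its values in R u {+oo}. *)
Definition proper_fun f : Prop :=
  (forall u, f u != -oo%E) /\ effdom f !=set0.

(* The modulus is not halved: f - nu ||.||^2 is convex. *)
Definition strongly_convex (nu : R) f : Prop :=
  forall u w (lam : R), effdom f u -> effdom f w -> 0 <= lam <= 1 ->
    (f (lam *: u + (1 - lam) *: w)%R
       + (nu * lam * (1 - lam) * enorm (u - w) ^+ 2)%:E
     <= lam%:E * f u + (1 - lam)%:E * f w)%E.

(* P(z): the minimizer of f - <z, .>, unique for f proper, lower
   semicontinuous and strongly convex. *)
Definition argmin_tilt f z : 'cV[R]_n :=
  get [set u | forall w, (f u - (dot z u)%:E <= f w - (dot z w)%:E)%E].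

(* D_f^z(w, u), meaningful when z is a subgradient of f at u, in particular
   for u = argmin_tilt f z. *)
Definition bregman f z w u : \bar R :=
  (f w - f u - (dot z (w - u)%R)%:E)%E.

End Functional.

(* T V = U B and T^* U' = V B'^* with U' the first l columns of U and B' the
   first l rows of B. *)
Definition golub_kahan (R : realType) (n1 n2 l : nat) (T : 'M[R]_(n1, n2))
    (U : 'M[R]_(n1, l + 1)) (B : 'M[R]_(l + 1, l)) (V : 'M[R]_(n2, l)) : Prop :=
  [/\ U^T *m U = 1%:M /\ V^T *m V = 1%:M,
      forall (i : 'I_(l + 1)) (j : 'I_l),
        i != j :> nat -> i != j.+1 :> nat -> B i j = 0,
      \rank B = l,
      T *m V = U *m B &
      T^T *m lsubmx U = V *m (usubmx B)^T].

Record rigkt (R : realType) (n1 n2 l q : nat) := Rigkt {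
  objf : 'cV[R]_n2 -> \bar R;
  gkU : 'I_q -> 'M[R]_(n1, l + 1);
  gkB : 'I_q -> 'M[R]_(l + 1, l);
  gkV : 'I_q -> 'M[R]_(n2, l);
  vdelta : 'I_q -> 'cV[R]_n1;
  delta : 'I_q -> R;
  gam : nat -> R;
  tau : R;
  mu0 : R;
  mu1 : R;
  zeta0 : 'cV[R]_n2;
  ninner : nat -> nat
}.

Section Algorithm.
Variables (R : realType) (n1 n2 l q : nat) (X : rigkt R n1 n2 l q).
Implicit Types (g : R) (i : 'I_q) (u z : 'cV[R]_n2) (k m K : nat).

Local Notation P := (argmin_tilt (objf X)).

Definition projT i : 'M[R]_(n1, n2) := gkU X i *m gkB X i *m (gkV X i)^T.

Definition Amh g i : 'M[R]_(l + 1) :=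
  inv_sqrtmx (g%:M + gkB X i *m (gkB X i)^T).

Definition hres g i u : 'cV[R]_(l + 1) :=
  Amh g i *m (gkU X i)^T *m (projT i *m u - vdelta X i).

Definition gdir g i u : 'cV[R]_n2 :=
  gkV X i *m (gkB X i)^T *m Amh g i *m hres g i u.

Definition violated g i u : bool :=
  tau X ^+ 2 * delta X i ^+ 2 < g * enorm (hres g i u) ^+ 2.

(* min{mu0 * a / b, mu1}, the quotient being +oo when b = 0. *)
Definition capped_step (a b : R) : R :=
  if b == 0 then mu1 X else Num.min (mu0 X * a / b) (mu1 X).

Definition gam_inner k m : R := gam X (\sum_(j < k) ninner X j + k + m)%N.

(* Only used for K >= 1. *)
Definition gam_outer K : R := gam X (\sum_(j < K) ninner X j + K).-1%N.

Definition t_inner g i u : R :=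
  if violated g i u
  then capped_step (enorm (hres g i u) ^+ 2) (enorm (gdir g i u) ^+ 2)
  else 0.

Definition inner_update k m i z : 'cV[R]_n2 :=
  z - t_inner (gam_inner k m) i (P z) *: gdir (gam_inner k m) i (P z).

Definition active K u : {set 'I_q} :=
  [set i | violated (gam_outer K) i u]%SET.

Definition g_outer K u : 'cV[R]_n2 :=
  \sum_(i in active K u) gdir (gam_outer K) i u.

Definition Phi_outer K u : R :=
  \sum_(i in active K u) enorm (hres (gam_outer K) i u) ^+ 2.

Definition t_outer K u : R :=
  if active K u == finset.set0 then 0
  else capped_step (Phi_outer K u) (enorm (g_outer K u) ^+ 2).

Definition outer_update K z : 'cV[R]_n2 :=
  z - t_outer K (P z) *: g_outer K (P z).

Fixpoint inner_run k (idx : nat -> 'I_q) z m : 'cV[R]_n2 :=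
  if m is m'.+1 then inner_update k m' (idx m') (inner_run k idx z m') else z.

(* idx k m is the index drawn at inner step (k, m). *)
Variable idx : nat -> nat -> 'I_q.

(* zeta_{k,0} *)
Fixpoint zeta_start k : 'cV[R]_n2 :=
  if k is k'.+1 then
    outer_update k'.+1 (inner_run k' (idx k') (zeta_start k') (ninner X k'))
  else zeta0 X.

(* zeta_{k,m} *)
Definition zeta_in k m : 'cV[R]_n2 := inner_run k (idx k) (zeta_start k) m.

(* zeta_K *)
Definition zeta_out K : 'cV[R]_n2 :=
  if K is k.+1 then zeta_in k (ninner X k) else zeta0 X.

Definition u_in k m : 'cV[R]_n2 := P (zeta_in k m).
Definition u_out K : 'cV[R]_n2 := P (zeta_out K).

(* h_{k,m}, t_{k,m}, Phi_K, t_K along the run *)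
Definition h_in k m : 'cV[R]_(l + 1) :=
  hres (gam_inner k m) (idx k m) (u_in k m).
Definition t_in k m : R := t_inner (gam_inner k m) (idx k m) (u_in k m).
Definition Phi_out K : R := Phi_outer K (u_out K).
Definition t_out K : R := t_outer K (u_out K).

Definition stops K : Prop :=
  forall i, gam_outer K * enorm (hres (gam_outer K) i (u_out K)) ^+ 2
            <= tau X ^+ 2 * delta X i ^+ 2.

(* The least K >= 1 with stops K, and +oo if there is none. *)
Definition kdelta : \bar R :=
  ereal_inf [set (K%:R)%:E | K in [set K : nat | (0 < K)%N /\ stops K]].

Definition Gamma_in (w : 'cV[R]_n2) k m : \bar R :=
  bregman (objf X) (zeta_in k m) w (u_in k m).
Definition Gamma_out (w : 'cV[R]_n2) K : \bar R :=
  bregman (objf X) (zeta_out K) w (u_out K).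

Definition solset (v : 'I_q -> 'cV[R]_n1) : set 'cV[R]_n2 :=
  [set u | effdom (objf X) u /\ forall i, projT i *m u = v i].

End Algorithm.

(* The indices drawn at the inner steps (k, m), m < nin k, are independent and
   uniformly distributed on 'I_q. *)
Definition uniform_draws (R : realType) (d : measure_display)
    (Omega : measurableType d) (Pr : probability Omega R) (q : nat)
    (nin : nat -> nat) (idx : nat -> nat -> Omega -> 'I_q) : Prop :=
  [/\ forall k m a, (m < nin k)%N -> measurable [set w | idx k m w = a],
      forall k m a, (m < nin k)%N ->
        Pr [set w | idx k m w = a] = (q%:R^-1)%:E &
      forall (J : seq (nat * nat)) (a : nat * nat -> 'I_q),
        uniq J -> (forall p, p \in J -> (p.2 < nin p.1)%N) ->
        Pr (\bigcap_(p in [set` J]) [set w | idx p.1 p.2 w = a p])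
        = (\prod_(p <- J) Pr [set w | idx p.1 p.2 w = a p])%E].

(* Main.v *)
(* Let z' = z - t g, u = P(z) and u' = P(z').  Strong convexity gives
   f(u') >= f(u) + <z, u' - u> + nu |u' - u|^2, and completing the square then
   yields D^{z'}(w, u') - D^z(w, u) <= t^2 |g|^2 / (4 nu) + t <g, w - u>.
   The step size satisfies t |g|^2 <= mu0 |h|^2.  Since T^l w is the exact data,
   <g, w - u> = <h, e> - |h|^2 with e the projected noise, gamma |e|^2 <= delta^2,
   so the discrepancy test forces <h, e> <= |h|^2 / tau.  Summing over the
   active indices gives the outer step. *)
Require Import Defs.
From HB Require Import structures.
From mathcomp Require Import all_boot all_order all_algebra.
From mathcomp Require Import all_classical all_reals all_analysis.
From mathcomp Require Import finmap ring lra.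

Import Order.TTheory GRing.Theory Num.Theory.
Import numFieldNormedType.Exports.

Local Open Scope classical_set_scope.
Local Open Scope ring_scope.

(** * Euclidean inner product on column vectors *)

Section Dot.
Context {R : realType} {n : nat}.
Implicit Types (u v w : 'cV[R]_n) (a : R).

Lemma dotE u v : dot u v = \sum_i u i 0 * v i 0.
Proof. by rewrite /dot !mxE; apply: eq_bigr => i _; rewrite mxE. Qed.

Lemma dotC u v : dot u v = dot v u.
Proof. by rewrite !dotE; apply: eq_bigr => i _; rewrite mulrC. Qed.

Lemma dotDr u v w : dot u (v + w) = dot u v + dot u w.
Proof. by rewrite /dot mulmxDr mxE. Qed.

Lemma dotNr u v : dot u (- v) = - dot u v.
Proof. by rewrite /dot mulmxN mxE. Qed.

Lemma dotZr a u v : dot u (a *: v) = a * dot u v.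
Proof. by rewrite /dot -scalemxAr mxE. Qed.

Lemma dotDl u v w : dot (u + v) w = dot u w + dot v w.
Proof. by rewrite !(dotC _ w) dotDr. Qed.

Lemma dotNl u v : dot (- u) v = - dot u v.
Proof. by rewrite !(dotC _ v) dotNr. Qed.

Lemma dotZl a u v : dot (a *: u) v = a * dot u v.
Proof. by rewrite !(dotC _ v) dotZr. Qed.

Lemma dot0l u : dot 0 u = 0.
Proof. by rewrite -(scale0r 0) dotZl mul0r. Qed.

Lemma dot_suml (I : finType) (A : {set I}) (F : I -> 'cV[R]_n) v :
  dot (\sum_(i in A) F i) v = \sum_(i in A) dot (F i) v.
Proof.
by apply: (big_morph (fun u => dot u v)) => [x y|]; rewrite ?dotDl ?dot0l.
Qed.

Lemma dot_ge0 u : 0 <= dot u u.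
Proof. by rewrite dotE sumr_ge0// => i _; rewrite -expr2 sqr_ge0. Qed.

Lemma dot_eq0 u : dot u u = 0 -> u = 0.
Proof.
move/eqP; rewrite dotE psumr_eq0 => [/allP u0|i _]; last first.
  by rewrite -expr2 sqr_ge0.
apply/colP => i; rewrite mxE; apply/eqP.
by have := u0 i (mem_index_enum _); rewrite -expr2 sqrf_eq0.
Qed.

Lemma enorm_ge0 u : 0 <= enorm u.
Proof. exact: sqrtr_ge0. Qed.

Lemma enorm_sqr u : enorm u ^+ 2 = dot u u.
Proof. by rewrite sqr_sqrtr// dot_ge0. Qed.

(** The balls of the compactness argument use the sup norm, strong convexity the Euclidean one; this
    links the two. *)
Lemma normr_sqr_le_dot u : `|u| ^+ 2 <= dot u u.
Proof.
rewrite [ `|u| ]/Num.norm/=.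
have [->|/mx_norm_neq0[[i j] /= ->]] := eqVneq (mx_norm u) 0.
  by rewrite expr0n/= dot_ge0.
rewrite ord1 real_normK ?num_real// dotE (bigD1 i)//= expr2 lerDl.
by rewrite sumr_ge0// => k _; rewrite -expr2 sqr_ge0.
Qed.

Lemma dot_continuous u : continuous (dot u).
Proof.
have -> : dot u = fun w => \sum_i u i 0 * w i 0.
  by apply/funext => w; rewrite dotE.
apply: continuous_big => [|i _ v]; first exact: add_continuous.
apply: (continuous_comp (@coord_continuous R n 1 i 0 v)).
exact: mulrl_continuous.
Qed.

End Dot.

Definition dotl := (@dotDr, @dotNr, @dotZr, @dotDl, @dotNl, @dotZl).

Lemma dot_mulmxr {R : realType} {m n : nat} (A : 'M[R]_(m, n))
    (u : 'cV[R]_m) (v : 'cV[R]_n) : dot u (A *m v) = dot (A^T *m u) v.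
Proof. by rewrite /dot trmx_mul trmxK mulmxA. Qed.

(** Bessel's inequality: the square of x - U U^T x expands to |x|^2 - |U^T x|^2. *)
Lemma dot_isometry_tr {R : realType} {m n : nat} (U : 'M[R]_(m, n))
    (x : 'cV[R]_m) :
  U^T *m U = 1%:M -> dot (U^T *m x) (U^T *m x) <= dot x x.
Proof.
move=> U1; have := dot_ge0 (x - U *m (U^T *m x)).
rewrite !dotl [dot (U *m _) x]dotC !dot_mulmxr.
rewrite [U^T *m (U *m _)]mulmxA U1 mul1mx.
lra.
Qed.

(** * Shifted Gram matrices and their inverse square roots *)

Section InverseSquareRoot.
Context {R : realType} {m n : nat}.
Variables (g : R) (B : 'M[R]_(m, n)).
Hypothesis g_gt0 : 0 < g.
Let A := g%:M + B *m B^T.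

Lemma dot_shifted_gram (x y : 'cV[R]_m) :
  dot x (A *m y) = g * dot x y + dot (B^T *m x) (B^T *m y).
Proof.
by rewrite mulmxDl dotDr mul_scalar_mx dotZr -mulmxA dot_mulmxr.
Qed.

(** A kernel vector r satisfies 0 = <r, A r> = g |r|^2 + |B^T r|^2, hence r = 0. *)
Lemma shifted_gram_unit : A \in unitmx.
Proof.
rewrite -unitmx_tr -row_free_unit -kermx_eq0; apply/eqP/row_matrixP => i.
set r := row i _.
have : r *m A^T = 0 by apply/sub_kermxP; exact: row_sub.
move=> /(congr1 trmx); rewrite trmx_mul trmxK trmx0 => r0.
have := dot_shifted_gram r^T r^T.
rewrite r0 [dot _ 0]dotC dot0l => E; rewrite row0.
apply: trmx_inj; rewrite trmx0; apply: dot_eq0; apply/eqP.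
rewrite eq_le dot_ge0 andbT -(pmulr_rle0 _ g_gt0).
by have := dot_ge0 (B^T *m r^T); lra.
Qed.

(* The first alternative is the junk value that [get] returns on an empty set
   of square roots; the estimates below hold for it too. *)
Lemma inv_sqrtmx_cases : inv_sqrtmx A = 0 \/
  (inv_sqrtmx A)^T = inv_sqrtmx A /\
  inv_sqrtmx A *m inv_sqrtmx A = invmx A.
Proof.
rewrite /inv_sqrtmx; case: xgetP => [S _ [St _ SS]|_]; first by right.
by left; apply/matrixP => i j; rewrite !mxE.
Qed.

Lemma inv_sqrtmx_sym : (inv_sqrtmx A)^T = inv_sqrtmx A.
Proof. by case: inv_sqrtmx_cases => [->|[]//]; rewrite trmx0. Qed.

Lemma inv_sqrtmx_bound (x : 'cV[R]_m) :
  g * dot (inv_sqrtmx A *m x) (inv_sqrtmx A *m x) <= dot x x.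
Proof.
have [->|[St SS]] := inv_sqrtmx_cases.
  by rewrite mul0mx dot0l mulr0 dot_ge0.
rewrite dot_mulmxr St mulmxA SS.
(* With z = B B^T y the left side becomes g^2 |y|^2 + g <y, z> and the right side g^2 |y|^2 + 2 g
   <y, z> + |z|^2, where <y, z> = |B^T y|^2 >= 0. *)
have [y ->] : exists y, x = A *m y.
  by exists (invmx A *m x); rewrite mulKVmx// shifted_gram_unit.
rewrite mulKmx ?shifted_gram_unit// dot_shifted_gram.
rewrite /A mulmxDl mul_scalar_mx -mulmxA; set z := B *m _.
have -> : dot (B^T *m y) (B^T *m y) = dot y z by rewrite [RHS]dot_mulmxr.
rewrite !dotl [dot z y]dotC.
have yz : 0 <= dot y z by rewrite dot_mulmxr dot_ge0.
have := mulr_ge0 (ltW g_gt0) yz; have := dot_ge0 z.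
by lra.
Qed.

End InverseSquareRoot.

(** * Minimization over compact sets *)

(** Without a minimizer, the open sets {F > r}, with r at or above some value of [F] on [K], cover
    [K]. A finite subcover misses a point of [K] whose value is at most each of its levels. *)
Lemma lower_semicontinuous_compact_min {R : realType} {T : ptopologicalType}
    (F : T -> \bar R) (K : set T) :
  compact K -> K !=set0 -> lower_semicontinuous F ->
  exists2 x, K x & forall y, K y -> (F x <= F y)%E.
Proof.
move=> cK [x0 Kx0] /lower_semicontinuousP lF; apply: contrapT => nomin.
have below x : K x -> exists2 y, K y & (F y < F x)%E.
  move=> Kx; apply: contrapT => nox; apply: nomin; exists x => // y Ky.
  by rewrite leNgt; apply/negP => yx; apply: nox; exists y.
pose D := [set r | exists2 y, K y & (F y <= r%:E)%E].
have := cK; rewrite compact_cover.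
move=> /(_ R D (fun r => [set x | r%:E < F x]%E))[//|x Kx|D' D'D KD'].
  have [y Ky yx] := below _ Kx.
  have [r yr rx] : exists2 r, (F y <= r%:E)%E & (r%:E < F x)%E.
    case: (F y) yx => [r rx| |]; first by exists r.
      by rewrite ltNge leey.
    case: (F x) => [r _| |]; last by rewrite ltxx.
      by exists (r - 1); rewrite ?leNye// lte_fin ltrBlDr ltrDl.
    by exists 0; rewrite ?leNye// ltry.
  by exists r => //; exists y.
(* Induction on the list of levels, keeping whichever witness has the smaller value. *)
have [y Ky yD'] : exists2 y, K y & forall r, r \in D' -> (F y <= r%:E)%E.
  have : forall s : seq R, {subset s <= D} ->
      exists2 y, K y & forall r, r \in s -> (F y <= r%:E)%E.
    elim=> [_|r s ih sD]; first by exists x0.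
    have [|y Ky ys] := ih; first by move=> t ts; apply: sD; rewrite inE ts orbT.
    have /set_mem[z Kz zr] := sD r (mem_head _ _).
    have [yz|/ltW zy] := leP (F y) (F z).
      exists y => // t; rewrite inE => /orP[/eqP->|/ys//].
      exact: le_trans zr.
    exists z => // t; rewrite inE => /orP[/eqP->//|/ys].
    exact: le_trans.
  by move=> /(_ D' D'D).
have [r /= rD' ry] := KD' _ Ky.
by have := lt_le_trans ry (yD' _ rD'); rewrite ltxx.
Qed.

(** Transposition is continuous and preserves the sup norm, so the ball is the continuous image of a
    compact ball of row vectors. *)
Lemma compact_closed_ball_col {R : realType} {n : nat} (x : 'cV[R]_n) (r : R) :
  compact (closed_ball_ Num.norm x r).
Proof.
have tr_le (m p : nat) (M : 'M[R]_(m, p)) : `|M^T| <= `|M|.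
  rewrite [ `|M^T| ]/Num.norm/=.
  have [->//|/mx_norm_neq0[[i j] /= ->]] := eqVneq (mx_norm M^T) 0.
  rewrite mxE [leRHS]/Num.norm/= mx_normrE.
  exact: (le_bigmax _ (fun ij : 'I_m * 'I_p => `|M ij.1 ij.2|) (j, i)).
have tr_cont : continuous (fun y : 'rV[R]_n => y^T).
  move=> y s /= /(nbhs_ballP y^T)[e e0 es]; apply/nbhs_ballP; exists e => //=.
  by move=> z [_ yz]; apply: es; split=> // i j; rewrite !mxE.
have -> : closed_ball_ Num.norm x r =
    (fun y : 'rV[R]_n => y^T) @` closed_ball_ Num.norm x^T r.
  apply/seteqP; split => [y yr|_ [y yr <-]]; rewrite /closed_ball_/= in yr *.
    exists y^T; last by rewrite trmxK.
    by rewrite -linearB; apply: le_trans yr; exact: tr_le.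
  by apply: le_trans yr; rewrite -[x in leLHS]trmxK -linearB; exact: tr_le.
apply: continuous_compact; first exact: continuous_subspaceT.
apply: bounded_closed_compact; last exact: closed_closed_ball_.
exists (r + `|x^T|); split; first exact: num_real.
move=> t rt y yr; apply: le_trans (ltW rt).
by rewrite -lerBlDr; apply: le_trans yr; rewrite distrC; exact: lerB_dist.
Qed.

(** * Strongly convex functions: existence of a minimizer and growth around it *)

Section StronglyConvexMinimization.
Context {R : realType} {n : nat}.
Context {nu : R} {F : 'cV[R]_n -> \bar R}.
Hypotheses (nu_gt0 : 0 < nu) (Fconv : strongly_convex nu F).

Lemma strongly_convex_fin {u w : 'cV[R]_n} {a b lam : R} :
  F u = a%:E -> F w = b%:E -> 0 <= lam <= 1 ->
  (F (lam *: u + (1 - lam) *: w)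
     <= (lam * a + (1 - lam) * b
         - nu * lam * (1 - lam) * dot (u - w) (u - w))%:E)%E.
Proof.
move=> Fu Fw lam01; rewrite EFinB leeBrDr// -enorm_sqr.
have := Fconv u w lam; rewrite /effdom/= Fu Fw !ltry.
by move=> /(_ isT isT lam01); rewrite -!EFinM -EFinD.
Qed.

(* Along the ray from [u0] through [w], strong convexity makes [F] grow
   quadratically from its minimum over a unit ball. *)
Lemma strongly_convex_has_min :
  proper_fun F -> lower_semicontinuous F -> exists u, forall w, (F u <= F w)%E.
Proof.
move=> [FNy [u0 u0F]] Flsc.
have fin u : (F u < +oo)%E -> exists a, F u = a%:E.
  by move: (FNy u); case: (F u) => [a| |]//; exists a.
have [a Fu0] := fin _ u0F.
have ball_min r : 0 <= r -> exists2 x, closed_ball_ Num.norm u0 r x &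
    forall y, closed_ball_ Num.norm u0 r y -> (F x <= F y)%E.
  move=> r0; apply: lower_semicontinuous_compact_min => //.
    exact: compact_closed_ball_col.
  by exists u0; rewrite /closed_ball_/= subrr normr0.
have u0_ball r : 0 <= r -> closed_ball_ Num.norm u0 r u0.
  by rewrite /closed_ball_/= subrr normr0.
have [x _ xmin] := ball_min 1 ler01.
have [c Fx] : exists c, F x = c%:E.
  by apply: fin; apply: le_lt_trans u0F; apply: xmin; exact: u0_ball.
have ca : c <= a by rewrite -lee_fin -Fx -Fu0; apply: xmin; exact: u0_ball.
(* At distance rho > r the convexity gain nu (rho - 1) exceeds a - c, the largest drop below F(u0)
   inside the unit ball. So F >= a out there, and a minimizer over the ball of radius [r] is
   global. *)
pose r := 1 + (a - c) / nu.
have r1 : 1 <= r by rewrite lerDl divr_ge0 ?subr_ge0// ltW.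
have [y _ ymin] := ball_min r (le_trans ler01 r1).
exists y => w; have [|rw] := leP `|u0 - w| r; first exact: ymin.
have [/fin[b Fw]|] := ltP (F w) +oo%E; last by rewrite leye_eq => /eqP->; rewrite leey.
have ya : (F y <= a%:E)%E.
  by rewrite -Fu0; apply/ymin/u0_ball/(le_trans ler01).
rewrite (le_trans ya)// Fw lee_fin leNgt; apply/negP => ba.
set rho := `|u0 - w| in rw; have rho1 : 1 < rho by exact: le_lt_trans r1 rw.
have rho0 : 0 < rho by exact: lt_trans rho1.
have lam01 : 0 <= rho^-1 <= 1.
  by rewrite invr_ge0 (ltW rho0)/= invf_le1// ltW.
have := strongly_convex_fin Fw Fu0 lam01.
(* [p] is the point of the segment from [u0] to [w] at sup distance 1 from [u0]. *)
set p := _ *: w + _ => Fp; have : (c%:E <= F p)%E.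
  rewrite -Fx; apply: xmin; rewrite /closed_ball_/= /p.
  rewrite (_ : _ - _ = rho^-1 *: (u0 - w)); last first.
    by apply/matrixP => i j; rewrite !mxE; ring.
  by rewrite normrZ gtr0_norm ?invr_gt0// -/rho mulVf// gt_eqF.
move=> /le_trans/(_ Fp); rewrite lee_fin.
have lam_rho : rho^-1 * rho = 1 by rewrite mulVf// gt_eqF.
have rhoD : rho ^+ 2 <= dot (w - u0) (w - u0).
  by rewrite /rho distrC; exact: normr_sqr_le_dot.
have : a - c < nu * (rho - 1) by rewrite mulrC -ltr_pdivrMr// ltrBrDl.
have lam0 : 0 < rho^-1 by rewrite invr_gt0.
have := ler_wpM2l (mulr_ge0 (mulr_ge0 (ltW nu_gt0) (ltW lam0)) (_ : 0 <= 1 - rho^-1)) rhoD.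
rewrite subr_ge0; case/andP: lam01 => _ lam1 /(_ lam1).
have -> : nu * rho^-1 * (1 - rho^-1) * rho ^+ 2 = nu * (rho - 1).
  transitivity (nu * (rho^-1 * rho) * (rho - rho^-1 * rho)); first ring.
  by rewrite lam_rho; ring.
have := mulr_gt0 lam0 (_ : 0 < a - b); rewrite subr_gt0 => /(_ ba).
by lra.
Qed.

(** Compare [u] with lam w + (1 - lam) u, divide by lam, and let lam tend to 0. *)
Lemma strongly_convex_min_growth {u w : 'cV[R]_n} {a b : R} :
  (forall y, (F u <= F y)%E) -> F u = a%:E -> F w = b%:E ->
  a + nu * dot (w - u) (w - u) <= b.
Proof.
move=> umin Fu Fw; set D := dot _ _.
have step (lam : R) : 0 < lam < 1 -> nu * D - lam * (nu * D) <= b - a.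
  move=> /andP[lam0 lam1]; have lam01 : 0 <= lam <= 1 by rewrite !ltW.
  have := le_trans (umin _) (strongly_convex_fin Fw Fu lam01).
  rewrite Fu lee_fin -/D => H; rewrite -(ler_pM2l lam0); lra.
have D0 : 0 <= nu * D by rewrite mulr_ge0 ?dot_ge0// ltW.
rewrite -lerBrDl; apply/ler_addgt0Pr => e e0.
have lam1 : 0 < nu * D + e + 1 by lra.
(* This lam lies in (0, 1) and makes the error lam nu D at most [e]. *)
have := step (e / (nu * D + e + 1)).
rewrite divr_gt0// ltr_pdivrMr// mul1r => /(_ ltac:(lra)).
suff : e / (nu * D + e + 1) * (nu * D) <= e by lra.
by rewrite mulrAC ler_pdivrMr// ler_wpM2l ?ltW//; lra.
Qed.

End StronglyConvexMinimization.

(** * Linear tilts of f and the map P *)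

Section Tilt.
Context {R : realType} {n : nat}.
Context {nu : R} {f : 'cV[R]_n -> \bar R}.
Hypotheses (nu_gt0 : 0 < nu) (fproper : proper_fun f)
  (flsc : lower_semicontinuous f) (fconv : strongly_convex nu f).
Variable z : 'cV[R]_n.
Let F (u : 'cV[R]_n) : \bar R := (f u - (dot z u)%:E)%E.

Lemma strongly_convex_tilt : strongly_convex nu F.
Proof.
have fin u : effdom F u -> exists a, f u = a%:E.
  rewrite /effdom/F/=; move: (fproper.1 u).
  by case: (f u) => [a| |]//; exists a.
move=> u w lam /fin[a fu] /fin[b fw] lam01.
have := strongly_convex_fin fconv fu fw lam01.
have := fproper.1 (lam *: u + (1 - lam) *: w).
rewrite /F fu fw; case: (f _) => [c _| |]//.
rewrite -!EFinB -!EFinM -!EFinD !lee_fin enorm_sqr !dotl.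
by lra.
Qed.

Lemma proper_fun_tilt : proper_fun F.
Proof.
split=> [u|]; first by move: (fproper.1 u); rewrite /F; case: (f u).
have [u uf] := fproper.2; exists u; move: uf; rewrite /effdom/F/=.
by move: (fproper.1 u); case: (f u) => [a _ _| |]//; exact: ltry.
Qed.

Lemma lower_semicontinuous_tilt : lower_semicontinuous F.
Proof.
move=> x a; rewrite /F lteBrDr// -EFinD => ax.
(* [b] splits the gap: near x both f > b and <z, .> < b - a hold, so the tilt exceeds [a]. *)
have [b ab bx] : exists2 b, a + dot z x < b & (b%:E < f x)%E.
  move: ax; case: (f x) => [r| |]//; last by exists (a + dot z x + 1); rewrite ?ltry// ltrDl.
  by rewrite lte_fin => ax; exists ((a + dot z x + r) / 2); rewrite ?lte_fin; lra.
have [V xV Vb] := flsc x b bx.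
exists (V `&` [set y | dot z y < b - a]).
  apply: filterI => //; apply: (@dot_continuous R n z x [set t | t < b - a]).
  by apply: lt_nbhsl; lra.
move=> y [Vy zy]; have {zy} yb : dot z y < b - a := zy.
rewrite /F lteBrDr// -EFinD.
by apply: lt_trans (Vb _ Vy); rewrite lte_fin; lra.
Qed.

(** Existence of a minimizer ensures that [get] does not return its default value. *)
Lemma argmin_tiltP w : (F (argmin_tilt f z) <= F w)%E.
Proof.
have [u umin] := strongly_convex_has_min nu_gt0 strongly_convex_tilt
  proper_fun_tilt lower_semicontinuous_tilt.
rewrite /argmin_tilt; case: xgetP => [y _ //|/(_ u)]; first exact.
by case.
Qed.

Lemma argmin_tilt_fin : exists a, f (argmin_tilt f z) = a%:E.
Proof.
have [u uF] := proper_fun_tilt.2.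
have := le_lt_trans (argmin_tiltP u) uF; rewrite /F.
have := fproper.1 (argmin_tilt f z).
by case: (f _) => [a| |]//; exists a.
Qed.

(** The subgradient inequality for [z] at P(z), sharpened by a quadratic term: growth of the tilt
    with its linear part moved back to f. *)
Lemma argmin_tilt_growth {w : 'cV[R]_n} {a b : R} :
  let u := argmin_tilt f z in f u = a%:E -> f w = b%:E ->
  a + dot z (w - u) + nu * dot (w - u) (w - u) <= b.
Proof.
move=> u fu fw.
have Fu : F u = (a - dot z u)%:E by rewrite /F fu EFinB.
have Fw : F w = (b - dot z w)%:E by rewrite /F fw EFinB.
have := strongly_convex_min_growth nu_gt0 strongly_convex_tilt argmin_tiltP Fu Fw.
by rewrite [dot z (w - u)]dotDr dotNr; lra.
Qed.

End Tilt.

(** * Change of the Bregman distance under one update *)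

Lemma bregman_step {R : realType} {n : nat} {nu : R} {f : 'cV[R]_n -> \bar R}
    (z g w : 'cV[R]_n) (t : R) :
  0 < nu -> proper_fun f -> lower_semicontinuous f -> strongly_convex nu f ->
  effdom f w ->
  (bregman f (z - t *: g) w (argmin_tilt f (z - t *: g))
     - bregman f z w (argmin_tilt f z)
   <= (t ^+ 2 * dot g g / (4 * nu) + t * dot g (w - argmin_tilt f z))%:E)%E.
Proof.
move=> nu0 fproper flsc fconv wf; set P := argmin_tilt f; set z' := z - t *: g.
have [a fu] := argmin_tilt_fin nu0 fproper flsc fconv z.
have [a' fu'] := argmin_tilt_fin nu0 fproper flsc fconv z'.
have [b fw] : exists b, f w = b%:E.
  by move: wf (fproper.1 w); rewrite /effdom/=; case: (f w) => [b| |]//; exists b.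
have growth := argmin_tilt_growth nu0 fproper flsc fconv z fu fu'.
rewrite -/P in fu fu' growth.
rewrite /bregman fw fu fu' -!EFinB lee_fin.
move: growth; rewrite -/(P z) -/(P z'); move: (P z) (P z') => u u' growth.
(* Used at d = u - u': the quadratic growth term absorbs t <g, u - u'>, which remains after
   replacing w - u' by w - u. *)
have square (d : 'cV[R]_n) : 0 <= nu * dot d d - t * dot g d
    + t ^+ 2 * dot g g / (4 * nu).
  rewrite [leRHS](_ : _ = nu * dot (d - (t / (2 * nu)) *: g)
    (d - (t / (2 * nu)) *: g)); first by rewrite mulr_ge0 ?dot_ge0// ltW.
  by rewrite !dotl (dotC d g); field; rewrite gt_eqF.
have := square (u - u'); rewrite [dot g (_ - _)]dotDr dotNr.
by move: growth; rewrite /z' !dotl; lra.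
Qed.

(** * Step sizes, discrepancy test and descent *)

Section Descent.
Context {R : realType} {n1 n2 l q : nat} {X : rigkt R n1 n2 l q}.
Hypotheses (tau_gt1 : 1 < tau X) (mu0_gt0 : 0 < mu0 X) (mu1_gt0 : 0 < mu1 X).

Lemma capped_step_ge0 (a b : R) : 0 <= a -> 0 <= b -> 0 <= capped_step X a b.
Proof.
move=> a0 b0; rewrite /capped_step; case: eqP => _; first exact: ltW.
by rewrite le_min (ltW mu1_gt0) divr_ge0// mulr_ge0// ltW.
Qed.

(** The cap only lowers the step, and at b = 0 the product vanishes. *)
Lemma capped_step_mul (a b : R) :
  0 <= a -> 0 <= b -> capped_step X a b * b <= mu0 X * a.
Proof.
move=> a0; rewrite /capped_step; case: eqVneq => [->|bn0 b0].
  by rewrite mulr0 mulr_ge0// ltW.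
by rewrite -ler_pdivlMr ?lt_neqAle 1?eq_sym ?bn0// ge_min lexx.
Qed.

Lemma dot_gdir_le {T : 'M[R]_(n1, n2)} {v : 'I_q -> 'cV[R]_n1} {w} (u : 'cV[R]_n2)
    {i : 'I_q} {g : R} :
  golub_kahan T (gkU X i) (gkB X i) (gkV X i) ->
  enorm (vdelta X i - v i) <= delta X i -> projT X i *m w = v i ->
  0 < g -> violated X g i u ->
  dot (gdir X g i u) (w - u) <= - (1 - (tau X)^-1) * enorm (hres X g i u) ^+ 2.
Proof.
move=> [[U1 _] _ _ _ _] noise Tw g0; rewrite /violated enorm_sqr.
set h := hres X g i u => viol.
have tau0 : 0 < tau X by exact: lt_trans tau_gt1.
pose S := Amh X g i; pose e := S *m ((gkU X i)^T *m (v i - vdelta X i)).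
have St : S^T = S by exact: inv_sqrtmx_sym.
(* Transposing gives <h, S B V^T (w - u)>. Since U^T U = 1, B V^T = U^T T^l, and T^l w is the exact
   data. *)
have -> : dot (gdir X g i u) (w - u) = dot h (e - h).
  rewrite /gdir -/h -/S -!mulmxA dotC dot_mulmxr.
  rewrite dot_mulmxr trmxK dot_mulmxr St.
  rewrite dotC; congr dot; rewrite /e /h /hres -/S -!mulmxA.
  rewrite -!mulmxBr.
  congr (_ *m _); rewrite opprB addrA subrK -Tw /projT -!mulmxA -!mulmxBr.
  by rewrite [in RHS]mulmxA U1 mul1mx.
have ge : g * dot e e <= delta X i ^+ 2.
  apply: le_trans (inv_sqrtmx_bound _ _ g0 _) _.
  apply: le_trans (dot_isometry_tr _ _ U1) _.
  by rewrite -opprB dotNl dotNr opprK -enorm_sqr lerXn2r ?nnegrE// ?enorm_ge0//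
    (le_trans (enorm_ge0 _) noise).
have eh : tau X ^+ 2 * dot e e <= dot h h.
  rewrite -(ler_pM2l g0) (le_trans _ (ltW viol))// mulrCA ler_wpM2l//.
  exact: sqr_ge0.
(* Expanding |h - tau e|^2 >= 0 gives 2 tau <h, e> <= |h|^2 + tau^2 |e|^2 <= 2 |h|^2. *)
have : dot h e <= (tau X)^-1 * dot h h.
  rewrite mulrC ler_pdivlMr// mulrC.
  have := dot_ge0 (h - tau X *: e); rewrite !dotl [dot e h]dotC.
  by move: eh; rewrite expr2; lra.
by rewrite dotDr dotNr; lra.
Qed.

(** Covers both kinds of update: [a] is |h|^2 for an inner step and Phi for an outer one. The loss
    mu0 / (4 nu) comes from t^2 |g|^2 <= t mu0 a. *)
Lemma bregman_descent {nu : R} (z g w : 'cV[R]_n2) (a : R) :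
  0 < nu -> proper_fun (objf X) -> lower_semicontinuous (objf X) ->
  strongly_convex nu (objf X) -> effdom (objf X) w -> 0 <= a ->
  dot g (w - argmin_tilt (objf X) z) <= - (1 - (tau X)^-1) * a ->
  let t := capped_step X a (enorm g ^+ 2) in
  (bregman (objf X) (z - t *: g) w (argmin_tilt (objf X) (z - t *: g))
     - bregman (objf X) z w (argmin_tilt (objf X) z)
   <= (- (1 - (tau X)^-1 - mu0 X / (4 * nu)) * t * a)%:E)%E.
Proof.
move=> nu0 fproper flsc fconv wf a0 ga.
set t := capped_step _ _ _ => /=.
have /le_trans := bregman_step z g w t nu0 fproper flsc fconv wf; apply.
rewrite lee_fin.
have g2 : 0 <= enorm g ^+ 2 by exact: sqr_ge0.
have t0 : 0 <= t by exact: capped_step_ge0.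
have : t * dot g g <= mu0 X * a.
  by rewrite -[dot g g]enorm_sqr; exact: capped_step_mul.
move=> /(ler_wpM2l t0) tg; have := ler_wpM2l t0 ga.
have : t ^+ 2 * dot g g / (4 * nu) <= t * (mu0 X * a) / (4 * nu).
  by rewrite ler_pM2r ?invr_gt0 ?mulr_gt0// expr2 -mulrA.
have -> : t * (mu0 X * a) / (4 * nu) = mu0 X / (4 * nu) * t * a by ring.
by lra.
Qed.

End Descent.

Theorem lemma4p1 (R : realType) (n1 n2 l q : nat)
  (hl : (0 < l)%N) (hln : (l < minn n1 n2)%N)
  (X : rigkt R n1 n2 l q)
  (nu : R) (hnu : 0 < nu)
  (fproper : proper_fun (objf X))
  (flsc : lower_semicontinuous (objf X))
  (fconv : strongly_convex nu (objf X))
  (T : 'I_q -> 'M[R]_(n1, n2))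
  (hGK : forall i, golub_kahan (T i) (gkU X i) (gkB X i) (gkV X i))
  (v : 'I_q -> 'cV[R]_n1)
  (hnoise : forall i, enorm (vdelta X i - v i) <= delta X i)
  (gam_gt0 : forall j, 0 < gam X j)
  (gam_decr : nonincreasing_seq (gam X))
  (gam_div : series (fun j => (gam X j)^-1) @ \oo --> +oo)
  (hninner : forall k, (0 < ninner X k)%N)
  (htau : 1 < tau X) (hmu0 : 0 < mu0 X) (hmu1 : 0 < mu1 X)
  (hC0 : 0 < 1 - (tau X)^-1 - mu0 X / (4 * nu))
  (d : measure_display) (Omega : measurableType d) (Pr : probability Omega R)
  (idx : nat -> nat -> Omega -> 'I_q)
  (hidx : uniform_draws Pr (ninner X) idx)
  (uhat : 'cV[R]_n2) (huhat : solset X v uhat) :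
  let C0 := 1 - (tau X)^-1 - mu0 X / (4 * nu) in
  forall (omega : Omega),
  let I := fun k m => idx k m omega in
  forall k m : nat, ((k%:R)%:E <= kdelta X I)%E -> (m < ninner X k)%N ->
    (Gamma_in X I uhat k m.+1 - Gamma_in X I uhat k m
       <= (- C0 * t_in X I k m * enorm (h_in X I k m) ^+ 2)%:E)%E
    /\ (Gamma_in X I uhat k.+1 0 - Gamma_out X I uhat k.+1
       <= (- C0 * t_out X I k.+1 * Phi_out X I k.+1)%:E)%E.
Proof.
move=> C0 omega I k m _ _; have [uhat_dom uhat_sol] := huhat.
have descent z g a := bregman_descent hmu0 hmu1 z g uhat a hnu fproper flsc fconv uhat_dom.
have residual u i j := dot_gdir_le htau u (hGK i) (hnoise i) (uhat_sol i)
  (gam_gt0 j).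
(* Handles zero steps. Finiteness of f at [uhat] and at P(z) is what makes the extended-real
   difference vanish. *)
have stationary z :
    (bregman (objf X) z uhat (argmin_tilt (objf X) z)
       - bregman (objf X) z uhat (argmin_tilt (objf X) z) <= 0)%E.
  have [a fu] := argmin_tilt_fin hnu fproper flsc fconv z.
  have /fineK : objf X uhat \is a fin_num.
    by rewrite fin_numE fproper.1/= -ltey.
  by rewrite /bregman fu => <-; rewrite -!EFinB subrr.
split.
- rewrite /Gamma_in /t_in /h_in /u_in.
  have -> : zeta_in X I k m.+1 =
    inner_update X k m (I k m) (zeta_in X I k m) by [].
  set z := zeta_in X I k m.
  rewrite /inner_update /t_inner; set u := argmin_tilt _ z.
  case: ifPn => viol; last first.
    by rewrite scale0r subr0 mulr0 mul0r; exact: stationary.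
  by apply: descent; [exact: sqr_ge0|exact: residual].
- rewrite /Gamma_in /Gamma_out /t_out /Phi_out /u_in /u_out.
  (* Both sides unfold to the outer update of the end of inner loop k. *)
  have -> : zeta_in X I k.+1 0 = outer_update X k.+1 (zeta_out X I k.+1) by [].
  set z := zeta_out X I k.+1.
  rewrite /outer_update /t_outer; set u := argmin_tilt _ z.
  case: ifPn => viol.
    by rewrite scale0r subr0 mulr0 mul0r; exact: stationary.
  apply: descent; first by apply: sumr_ge0 => i _; exact: sqr_ge0.
  (* Membership in the active set is the violated test that [residual] asks for, so the bounds add
     up termwise. *)
  rewrite /g_outer dot_suml /Phi_outer mulr_sumr; apply: ler_sum => i.
  by rewrite inE => ?; exact: residual.
Qed.
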